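(* The permutation mechanism is at most $2/3$-optimal on $\mathcal{G}^+$, the class of finite loopless directed graphs in which every vertex has outdegree at least $1$: if the permutation mechanism is $\alpha$-optimal on $\mathcal{G}^+$, then $\alpha\le 2/3$.
   Context: Graphs are finite directed graphs $G=(N,E)$ with vertex set $N=\{1,\dots,n\}$, $n\ge 1$, and $E\subseteq\{(i,j)\in N\times N: i\ne j\}$. For $S\subseteq N$ and $i\in N$, $\delta^-_S(i)=|\{j\in S:(j,i)\in E\}|$ is the indegree of $i$ from $S$; $\delta^-(i,G)=\delta^-_N(i)$; and $\Delta(G)=\max_{i\in N}\delta^-(i,G)$. $\mathcal{G}^+$ is the set of all such graphs in which every vertex has at least one outgoing edge. A selection mechanism maps each graph to a probability distribution on its vertices (the selected vertex is drawn from this distribution). It is $\alpha$-optimal on a class $\mathcal{G}'$ of graphs if for every $G\in\mathcal{G}'$ with $\Delta(G)>0$ the expected indegree of the selected vertex is at least $\alpha\,\Delta(G)$. Permutation mechanism. On input $G=(N,E)$ with $|N|=n$: choose a permutation $(\pi_1,\dots,\pi_n)$ of $N$ uniformly at random, and write $\pi_{<j}=\{\pi_1,\dots,\pi_{j-1}\}$. Set $c:=\pi_1$ and $d:=0$. For $j=2,\dots,n$ in this order: if $\delta^-_{\pi_{<j}\setminus\{c\}}(\pi_j)\ge d$, then set $c:=\pi_j$ and $d:=\delta^-_{\pi_{<j}}(\pi_j)$ (otherwise leave $c,d$ unchanged). Return $c$. *)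

(* Defs.v *)
From mathcomp Require Import all_boot all_order all_fingroup all_algebra.
From mathcomp Require Import reals.

Set Implicit Arguments.
Unset Strict Implicit.
Unset Printing Implicit Defensive.

Import Order.TTheory GRing.Theory Num.Theory.
Local Open Scope ring_scope.

(* Vertices are numbered from 0: the vertex set {1, ..., n} is 'I_n.  The edge
   (i, j) goes from i to j. *)
Record digraph (n : nat) : Type := Digraph {
  edges : {set 'I_n * 'I_n};
  edges_loopless : forall i : 'I_n, (i, i) \notin edges }.

Definition indeg_from (n : nat) (G : digraph n) (S : {set 'I_n}) (i : 'I_n) : nat :=
  #|[set j in S | (j, i) \in edges G]|.

Definition indeg (n : nat) (G : digraph n) (i : 'I_n) : nat :=
  indeg_from G [set: 'I_n] i.

Definition max_indeg (n : nat) (G : digraph n) : nat :=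
  (\max_(i < n) indeg G i)%N.

Definition outdeg (n : nat) (G : digraph n) (i : 'I_n) : nat :=
  #|[set j | (i, j) \in edges G]|.

(* Graphs are nonempty, so classes and mechanisms range over digraph n.+1. *)
Definition graph_class : Type := forall n : nat, digraph n.+1 -> Prop.

Definition Gplus : graph_class :=
  fun n G => forall i : 'I_n.+1, (1 <= outdeg G i)%N.

Record distribution (R : realType) (T : finType) : Type := Distribution {
  prob :> T -> R;
  prob_ge0 : forall x : T, 0 <= prob x;
  prob_sum1 : \sum_(x : T) prob x = 1 }.

Definition selection_mechanism (R : realType) : Type :=
  forall n : nat, digraph n.+1 -> distribution R 'I_n.+1.

Definition expected_indeg (R : realType) (n : nat) (G : digraph n)
    (p : distribution R 'I_n) : R :=
  \sum_(i < n) p i * (indeg G i)%:R.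

Definition alpha_optimal (R : realType) (alpha : R) (C : graph_class)
    (f : selection_mechanism R) : Prop :=
  forall (n : nat) (G : digraph n.+1), C n G -> (0 < max_indeg G)%N ->
    alpha * (max_indeg G)%:R <= expected_indeg G (f n G).

(* The ordering (pi_1, ..., pi_n) is a permutation s with pi_(j+1) = s j,
   0 <= j < n. *)
Definition before (n : nat) (s : 'S_n) (j : 'I_n) : {set 'I_n} :=
  [set s k | k : 'I_n & (k < j)%N].

(* The state cd is the pair (c, d). *)
Definition perm_step (n : nat) (G : digraph n) (s : 'S_n)
    (cd : 'I_n * nat) (j : 'I_n) : 'I_n * nat :=
  if (cd.2 <= indeg_from G (before s j :\ cd.1) (s j))%N
  then (s j, indeg_from G (before s j) (s j))
  else cd.

(* [seq lift ord0 k | k : 'I_n] is the increasing list of the positions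
   1, ..., n of 'I_n.+1. *)
Definition perm_output (n : nat) (G : digraph n.+1) (s : 'S_n.+1) : 'I_n.+1 :=
  (foldl (perm_step G s) (s ord0, 0%N) [seq lift ord0 k | k : 'I_n]).1.

Definition perm_prob (R : realType) (n : nat) (G : digraph n.+1)
    (i : 'I_n.+1) : R :=
  #|[set s : 'S_n.+1 | perm_output G s == i]|%:R / #|{: 'S_n.+1}|%:R.

Lemma perm_prob_ge0 (R : realType) (n : nat) (G : digraph n.+1) (i : 'I_n.+1) :
  0 <= perm_prob R G i.
Proof. by rewrite divr_ge0 ?ler0n. Qed.

Lemma perm_prob_sum1 (R : realType) (n : nat) (G : digraph n.+1) :
  \sum_(i : 'I_n.+1) perm_prob R G i = 1.
Proof.
rewrite -mulr_suml -natr_sum.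
have -> : (\sum_(i : 'I_n.+1) #|[set s : 'S_n.+1 | perm_output G s == i]|)%N
          = #|{: 'S_n.+1}|.
  rewrite -[RHS]sum1_card (partition_big (perm_output G) predT) //=.
  by apply: eq_bigr => i _; rewrite -sum1_card; apply: eq_bigl => s; rewrite inE.
rewrite divff // pnatr_eq0 -lt0n; apply/card_gt0P; by exists 1%g.
Qed.

Definition permutation_mechanism (R : realType) : selection_mechanism R :=
  fun n G => Distribution (perm_prob_ge0 R G) (perm_prob_sum1 R G).

(* Main.v *)
Require Import Defs.
From mathcomp Require Import all_boot all_order all_fingroup all_algebra.
From mathcomp Require Import reals.
From mathcomp Require Import zify lra.
Import Order.TTheory GRing.Theory Num.Theory.
Local Open Scope ring_scope.

(** Take a vertex [v] of indegree 2 with in-neighbours [a] and [b], where [v]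
    points back to [a], together with [m] disjoint 2-cycles.  Every other vertex
    has indegree at most 1, so the mechanism achieves at most [1 + P(v wins)].
    If [v] wins without having seen both [a] and [b], it holds a score of at most
    1, and the second vertex of any 2-cycle not completed before [v] would
    displace it.  So [v] comes last either in [{v, a, b}] or among [v] and the
    [2m] vertices of the 2-cycles: [P(v wins) <= 1/3 + 1/(2m+1)].  Let [m] grow. *)

Lemma mem_before {n : nat} (s : 'S_n) (j x : 'I_n) :
  (x \in before s j) = (s^-1%g x < j)%N.
Proof.
apply/imsetP/idP => [[k + ->]|ltxj]; first by rewrite inE permK.
by exists (s^-1%g x); rewrite ?inE ?permKV.
Qed.

(** The state right after [s q] is accepted. *)
Definition candidate {n : nat} (G : digraph n) (s : 'S_n) (q : 'I_n) : 'I_n * nat :=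
  (s q, indeg_from G (before s q) (s q)).

(** The state never changes between acceptances. So the final state is that of the last accepted
    position [q'], and every later position failed its test against exactly this state. The start
    [q] is arbitrary so that the induction can restart at each acceptance. *)
Lemma foldl_perm_step {n : nat} (G : digraph n) (s : 'S_n) (q : 'I_n)
    (l : seq 'I_n) :
  path (fun i j : 'I_n => (i < j)%N) q l ->
  exists q' : 'I_n, [/\ foldl (perm_step G s) (candidate G s q) l = candidate G s q',
    q' \in q :: l &
    forall j, j \in l -> (q' < j)%N ->
      (indeg_from G (before s j :\ s q') (s j) < indeg_from G (before s q') (s q'))%N].
Proof.
have lt_tr : transitive (fun i j : 'I_n => (i < j)%N) by move=> ? ? ?; apply: ltn_trans.
elim: l q => [|j l IHl] q /=; first by exists q; rewrite mem_head.
case/andP=> ltqj pth; rewrite {2}/perm_step /=.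
case: leqP => [_|blocked].
  have [q' [-> q'in q'P]] := IHl j pth.
  exists q'; split=> // [|k]; first by rewrite inE q'in orbT.
  rewrite inE => /predU1P[->|]; last exact: q'P.
  move: q'in; rewrite inE => /predU1P[->|]; first by rewrite ltnn.
  by move=> /(allP (order_path_min lt_tr pth)) /ltn_trans lt /lt; rewrite ltnn.
(* A blocked [j] leaves [q] in charge, so the induction continues from [q] with [j] dropped. *)
have pthq : path (fun i j : 'I_n => (i < j)%N) q l.
  by case: l pth {IHl} => //= k l /andP[ltjk ->]; rewrite (ltn_trans ltqj).
have [q' [-> q'in q'P]] := IHl q pthq.
exists q'; split=> // [|k].
  by move: q'in; rewrite !inE => /orP[->|->]; rewrite ?orbT.
rewrite inE => /predU1P[->|]; last exact: q'P.
move: q'in; rewrite inE => /predU1P[-> //|].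
by move=> /(allP (order_path_min lt_tr pth)) /ltn_trans lt /lt; rewrite ltnn.
Qed.

Lemma perm_output_unbeaten {n : nat} (G : digraph n.+1) (s : 'S_n.+1) (u : 'I_n.+1) :
  let v := perm_output G s in
  (s^-1%g v < s^-1%g u)%N ->
  (indeg_from G (before s (s^-1%g u) :\ v) u
     < indeg_from G (before s (s^-1%g v)) v)%N.
Proof.
rewrite /perm_output.
(* Nothing precedes the first position, so the initial score 0 is a genuine indegree. *)
have -> : (s ord0, 0%N) = candidate G s ord0.
  congr (_, _); apply/esym/eqP; rewrite cards_eq0; apply/eqP/setP => x.
  by rewrite !inE mem_before.
have pth : path (fun i j : 'I_n.+1 => (i < j)%N) ord0 [seq lift ord0 k | k : 'I_n].
  have -> : [seq lift ord0 k | k : 'I_n] = behead (enum 'I_n.+1).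
    by rewrite enum_ordSl.
  have : sorted (relpre val ltn) (enum 'I_n.+1).
    by rewrite -sorted_map val_enum_ord iota_ltn_sorted.
  by rewrite enum_ordSl.
have [q [-> _ qP]] := foldl_perm_step G s _ _ pth.
rewrite /= permK => ltqu; rewrite -{2}(permKV s u); apply: qP => //.
have [k -> |eq0] := unliftP ord0 (s^-1%g u).
  by apply/mapP; exists k; rewrite ?mem_enum.
by rewrite eq0 in ltqu.
Qed.

Definition last_in {n : nat} (A : {set 'I_n}) (v : 'I_n) : {set 'S_n} :=
  [set s : 'S_n | [forall x in A, (s^-1%g x <= s^-1%g v)%N]].

(* The elements of [A] are equally likely to come last. *)
Lemma card_last_in {n : nat} (A : {set 'I_n}) (v : 'I_n) :
  v \in A -> (#|A| * #|last_in A v| <= #|{: 'S_n}|)%N.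
Proof.
move=> vA; rewrite -sum_nat_const.
(* Composing [s] with the transposition of [v] and [x], which preserves [A], turns orders with [v]
   last into orders with [x] last. *)
have cardE x : x \in A -> #|last_in A v| = #|last_in A x|.
  move=> xA; have tA y : (tperm v x y \in A) = (y \in A).
    by case: tpermP => [->|->|]; rewrite ?vA ?xA.
  rewrite -(card_imset _ (mulIg (tperm v x))); congr #|pred_of_set _|.
  apply/setP => s; apply/imsetP/idP => [[t + ->]|].
    rewrite !inE => /forall_inP tP; apply/forall_inP => y yA.
    by rewrite !invMg !permM tpermV tpermR tP ?tA.
  rewrite inE => /forall_inP sP; exists (s * tperm v x)%g.
    rewrite inE; apply/forall_inP => y yA.
    by rewrite !invMg !permM tpermV tpermL sP ?tA.
  by rewrite -mulgA tperm2 mulg1.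
rewrite (eq_bigr _ cardE).
under eq_bigr => x _ do rewrite -sum1_card big_mkcond /=.
rewrite exchange_big /= -sum1_card; apply: leq_sum => s _.
(* Each order [s] is counted at most once, since two last elements of [A] share a position. *)
rewrite -big_mkcondr /= sum1dep_card; apply/card_le1_eqP => x y.
rewrite !inE => /andP[xA /forall_inP xP] /andP[yA /forall_inP yP].
by apply: (@perm_inj _ s^-1%g); apply/val_inj/anti_leq; rewrite xP ?yP.
Qed.

(* On [0, ..., 2m+2]: the 2-cycles [2k <-> 2k+1], and the extra edge from [2m+2]
   to the vertex [v = 0]; so [a = 1] and [b = 2m+2]. *)
Definition partner {m : nat} (i : 'I_m.*2.+3) : 'I_m.*2.+3 :=
  inord (if odd i then i.-1 else i.+1).

Definition target {m : nat} (i : 'I_m.*2.+3) : 'I_m.*2.+3 :=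
  if i == ord_max then ord0 else partner i.

(** At [ord_max] the successor is out of range and [inord] returns a default value, hence the
    hypothesis. *)
Lemma val_partner {m : nat} (i : 'I_m.*2.+3) :
  i != ord_max -> partner i = (if odd i then i.-1 else i.+1) :> nat.
Proof.
move=> /eqP neq; rewrite inordK //.
have : (i : nat) <> m.*2.+2 by move=> e; apply: neq; apply/val_inj.
by have := ltn_ord i; case: ifP; lia.
Qed.

Lemma partner_neq {m : nat} (i : 'I_m.*2.+3) : i != ord_max -> partner i != i.
Proof.
move=> ni; rewrite -val_eqE /= val_partner //.
by case: ifP => [odd_i|_]; [case: (val i) odd_i|]; lia.
Qed.

Lemma partner_max {m : nat} (i : 'I_m.*2.+3) :
  i != ord_max -> partner i != ord_max.
Proof.
move=> ni; rewrite -val_eqE /= val_partner //.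
have : (i : nat) <> m.*2.+2 by move=> e; case/eqP: ni; apply/val_inj.
by have := ltn_ord i; case: ifP; lia.
Qed.

Lemma partnerK {m : nat} (i : 'I_m.*2.+3) : i != ord_max -> partner (partner i) = i.
Proof.
move=> ni; apply/val_inj; rewrite /= val_partner ?partner_max // val_partner //.
by case: (boolP (odd i)) => odd_i; case: ifP; lia.
Qed.

Lemma target_loopless {m : nat} (i : 'I_m.*2.+3) :
  (i, i) \notin [set e : 'I_m.*2.+3 * 'I_m.*2.+3 | target e.1 == e.2].
Proof.
by rewrite inE /= /target; case: (eqVneq i ord_max) => [->|/partner_neq].
Qed.

Definition target_graph (m : nat) : digraph m.*2.+3 :=
  Digraph (@target_loopless m).

Lemma mem_target_graph {m : nat} (i j : 'I_m.*2.+3) :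
  ((i, j) \in edges (target_graph m)) = (target i == j).
Proof. by rewrite inE. Qed.

Lemma target_graph_Gplus (m : nat) : Gplus (target_graph m).
Proof.
by move=> i; apply/card_gt0P; exists (target i); rewrite inE mem_target_graph.
Qed.

Lemma target_eq0 {m : nat} (j : 'I_m.*2.+3) :
  (target j == ord0) = (j \in [set partner ord0; ord_max]).
Proof.
rewrite !inE /target; case: (eqVneq j ord_max) => [_|nj]; first by rewrite eqxx orbT.
rewrite orbF; apply/eqP/eqP => [<-|->]; by rewrite partnerK.
Qed.

Lemma indeg_target0 (m : nat) : indeg (target_graph m) ord0 = 2%N.
Proof.
rewrite /indeg /indeg_from -[RHS](_ : #|[set partner ord0; ord_max : 'I_m.*2.+3]| = 2%N).
  by apply: eq_card => j; rewrite inE in_setT mem_target_graph target_eq0.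
by rewrite cards2 partner_max.
Qed.

Lemma indeg_target (m : nat) (i : 'I_m.*2.+3) :
  i != ord0 -> (indeg (target_graph m) i <= 1)%N.
Proof.
move=> ni; rewrite -(cards1 (partner i)); apply/subset_leq_card/subsetP => j.
rewrite !inE /= /target; case: (eqVneq j ord_max) => [_ /eqP i0|nj /eqP <-].
  by rewrite -i0 eqxx in ni.
by rewrite partnerK.
Qed.

Lemma perm_output_target0 {m : nat} (s : 'S_m.*2.+3) :
  perm_output (target_graph m) s = ord0 ->
  s \in last_in (ord0 |: [set partner ord0; ord_max]) ord0
     :|: last_in (~: [set partner ord0; ord_max]) ord0.
Proof.
move=> out0; rewrite inE orbC -implyNb; apply/implyP.
(* If [v] is not last in the second set, some [x] in a 2-cycle avoiding [v] comes after [v]. *)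
rewrite inE => /forall_inPn[x]; rewrite !inE => /norP[xp xm]; rewrite -ltnNge => lt0x.
have x0 : x != ord0 by apply: contraTneq lt0x => ->; rewrite ltnn.
have px0 : partner x != ord0 by apply: contra_neq xp => <-; rewrite partnerK.
(* [u] is the later vertex of the 2-cycle of [x], and [w] the earlier one. *)
have [u [w [lt0u ltwu w0 wu]]] : exists u w : 'I_m.*2.+3,
    [/\ (s^-1%g ord0 < s^-1%g u)%N, (s^-1%g w < s^-1%g u)%N, w != ord0 & target w = u].
  have : (s^-1%g x : nat) != s^-1%g (partner x).
    by rewrite val_eqE (inj_eq perm_inj) eq_sym partner_neq.
  rewrite neq_ltn => /orP[lt|lt].
    exists (partner x), x; split=> //; first exact: ltn_trans lt.
    by rewrite /target (negPf xm).
  exists x, (partner x); split=> //.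
  by rewrite /target (negPf (partner_max _ xm)) partnerK.
have := perm_output_unbeaten (target_graph m) s u; rewrite out0 => /(_ lt0u) lt_score.
(* The edge from [w] counts in the test of [u] because [w] is not the current candidate [v]. As [u]
   still fails, the score of [v] exceeds 1. *)
have seen2 : (2 <= indeg_from (target_graph m) (before s (s^-1%g ord0)) ord0)%N.
  apply: leq_trans lt_score; rewrite ltnS; apply/card_gt0P; exists w.
  by rewrite !inE w0 mem_before ltwu /= wu.
have sub : [set j in before s (s^-1%g ord0) | (j, ord0) \in edges (target_graph m)]
    \subset [set partner ord0; ord_max].
  by apply/subsetP => j; rewrite inE mem_target_graph target_eq0 => /andP[].
(* With only two in-neighbours, a score of 2 means that both come before [v]. *)
have /setP eqset : [set j in before s (s^-1%g ord0) | (j, ord0) \in edges (target_graph m)]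
    = [set partner ord0; ord_max].
  by apply/eqP; rewrite eqEcard sub cards2 partner_max.
apply/forall_inP => j; rewrite !inE => /predU1P[-> //|jP].
by have := eqset j; rewrite !inE jP mem_before => /andP[/ltnW].
Qed.

(** Union bound over the two events, whose sets have 3 and 2m+1 elements. *)
Lemma perm_prob_target0 (R : realType) (m : nat) :
  perm_prob R (target_graph m) ord0 <= 1 / 3 + 1 / m.*2.+1%:R.
Proof.
have N0 : (0 : R) < #|{: 'S_m.*2.+3}|%:R.
  by rewrite ltr0n; apply/card_gt0P; exists 1%g.
have card2 : #|[set partner ord0; ord_max : 'I_m.*2.+3]| = 2%N.
  by rewrite cards2 partner_max.
have nm0 : (ord0 : 'I_m.*2.+3) \notin [set partner ord0; ord_max].
  by rewrite !inE negb_or eq_sym partner_neq.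
have le3 := @card_last_in _ (ord0 |: [set partner ord0; ord_max : 'I_m.*2.+3]) ord0.
have leB := @card_last_in _ (~: [set partner ord0; ord_max : 'I_m.*2.+3]) ord0.
rewrite setU11 cardsU1 nm0 card2 add1n in le3.
rewrite inE nm0 cardsCs setCK card2 card_ord !subSS subn0 in leB.
have card_le : (#|[set s | perm_output (target_graph m) s == ord0]| <=
    #|last_in (ord0 |: [set partner ord0; ord_max : 'I_m.*2.+3]) ord0|
    + #|last_in (~: [set partner ord0; ord_max : 'I_m.*2.+3]) ord0|)%N.
  apply: leq_trans (leq_card_setU _ _); apply/subset_leq_card/subsetP => s.
  by rewrite inE => /eqP /perm_output_target0.
rewrite /perm_prob ler_pdivrMr // mulrDl.
apply: le_trans (_ : _ <= (_ + _)%:R) _; first by rewrite ler_nat; exact: card_le.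
rewrite natrD lerD // mulrAC mul1r ler_pdivlMr ?ltr0n // -natrM ler_nat mulnC.
  exact: le3.
exact: leB.
Qed.

Lemma expected_indeg_target {R : realType} {m : nat}
    (p : distribution R 'I_m.*2.+3) :
  expected_indeg (target_graph m) p <= 1 + p ord0.
Proof.
(* Writing 1 as the total mass allows a termwise comparison. *)
rewrite -[X in _ <= X + _](prob_sum1 p) /expected_indeg.
rewrite (bigD1 ord0) //= [in leRHS](bigD1 ord0) //= indeg_target0 mulr_natr mulr2n.
rewrite [leRHS]addrAC lerD2l.
apply: ler_sum => i ni; rewrite -[leRHS]mulr1 ler_wpM2l ?prob_ge0 //.
by rewrite lern1 indeg_target.
Qed.

Theorem mainTheorem6 (R : realType) (alpha : R) :
  alpha_optimal alpha Gplus (permutation_mechanism R) -> alpha <= 2 / 3.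
Proof.
move=> opt; rewrite leNgt; apply/negP => gt_alpha.
have bound m : alpha * 2 <= 1 + (1 / 3 + 1 / m.*2.+1%:R).
  have max_ge2 : (2 <= max_indeg (target_graph m))%N.
    by rewrite -(indeg_target0 m); exact: leq_bigmax.
  apply: le_trans (lerD (lexx 1) (perm_prob_target0 R m)).
  apply: le_trans (expected_indeg_target (permutation_mechanism R (target_graph m))).
  apply: le_trans (opt _ _ (target_graph_Gplus m) (ltnW max_ge2)).
  (* Lowering the maximum indegree to 2 requires [alpha] to be nonnegative, which [gt_alpha]
     gives. *)
  by rewrite ler_wpM2l ?ler_nat //; lra.
(* As m grows, the right side of [bound] tends to 4/3; it suffices that 1/(2m+1) drops below this
   gap. *)
have eps_gt0 : 0 < alpha * 2 - 4 / 3 by lra.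
have [m lt_m] : exists m, (alpha * 2 - 4 / 3)^-1 < m%:R.
  by exists (Num.bound (alpha * 2 - 4 / 3)^-1); rewrite archi_boundP // invr_ge0 ltW.
have lt_m' : (alpha * 2 - 4 / 3)^-1 < m.*2.+1%:R.
  by apply: lt_le_trans lt_m _; rewrite ler_nat; lia.
have := bound m; have : m.*2.+1%:R^-1 < alpha * 2 - 4 / 3.
  by rewrite -[ltRHS]invrK ltf_pV2 ?posrE ?invr_gt0 ?ltr0n.
by rewrite !div1r; move: (_.+1%:R^-1) => e; lra.
Qed.
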